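(* Let $k, t \in \mathbb{N}$. If $t < \frac{k^k}{k!}$, then $\chi_{DP}(K_{k,t}) < k+1$.
   Context: $\mathbb{N}=\{1,2,3,\ldots\}$. All graphs are finite and simple; $K_{k,t}$ is the complete bipartite graph with parts of sizes $k$ and $t$. A cover of a graph $G$ is a pair $\mathcal{H}=(L,H)$ where $H$ is a graph and $L: V(G) \to \mathcal{P}(V(H))$ satisfies: (1) the sets $\{L(u): u \in V(G)\}$ partition $V(H)$; (2) for every $u \in V(G)$, $H[L(u)]$ is complete; (3) if $E_H(L(u),L(v))$ (the set of edges of $H$ with one endpoint in $L(u)$ and the other in $L(v)$) is nonempty, then $u=v$ or $uv \in E(G)$; (4) if $uv \in E(G)$ then $E_H(L(u),L(v))$ is a matching (possibly empty). The cover is $k$-fold if $|L(u)|=k$ for all $u$. An $\mathcal{H}$-coloring of $G$ is an independent set of $H$ of size $|V(G)|$. The DP-chromatic number $\chi_{DP}(G)$ is the smallest $k \in \mathbb{N}$ such that $G$ has an $\mathcal{H}$-coloring for every $k$-fold cover $\mathcal{H}$ of $G$. *)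

(* Defs.v *)
From mathcomp Require Import all_boot.
From mathcomp Require Import boolp.

Set Implicit Arguments.
Unset Strict Implicit.
Unset Printing Implicit Defensive.

Record sgraph := SGraph {
  vertex :> finType;
  edge : rel vertex;
  edge_sym : symmetric edge;
  edge_irr : irreflexive edge }.

Section Graphs.
Variable H : sgraph.
Implicit Types A B I : {set H}.

Definition edges_between A B : {set {set H}} :=
  [set [set x; y] | x in A, y in B & edge x y].

(* Edges are two-element vertex sets; a matching is a set of pairwise disjoint
   edges. *)
Definition matching (M : {set {set H}}) := trivIset M.

Definition clique A := [forall x in A, forall y in A, (x != y) ==> edge x y].

Definition independent A := [forall x in A, forall y in A, ~~ edge x y].

End Graphs.

(* The lists partition the vertices as a family indexed by [G]: distinct
   vertices of [G] have disjoint lists. *)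
Record cover (G : sgraph) := Cover {
  cgraph : sgraph;
  clist : G -> {set cgraph};
  clist_disjoint : forall u v : G, u != v -> [disjoint clist u & clist v];
  clist_cover : \bigcup_(u : G) clist u = [set: cgraph];
  clist_clique : forall u : G, clique (clist u);
  clist_edges : forall u v : G,
    edges_between (clist u) (clist v) != set0 -> u = v \/ edge u v;
  clist_matching : forall u v : G,
    edge u v -> matching (edges_between (clist u) (clist v)) }.

Definition kfold (G : sgraph) (k : nat) (C : cover G) : Prop :=
  forall u : G, #|clist C u| = k.

Definition coloring (G : sgraph) (C : cover G) (I : {set cgraph C}) : Prop :=
  independent I /\ #|I| = #|G|.

Definition DP_colorable (G : sgraph) (k : nat) : Prop :=
  forall C : cover G, kfold k C -> exists I : {set cgraph C}, coloring I.

Lemma cover_neighbor_uniq (G : sgraph) (C : cover G) (v : G) (x y z : cgraph C) :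
  x \notin clist C v -> y \in clist C v -> z \in clist C v ->
  edge x y -> edge x z -> y = z.
Proof.
move=> xNv yv zv exy exz.
have : x \in [set: cgraph C] by [].
rewrite -(clist_cover C) => /bigcupP[u _ xu].
have Ey : [set x; y] \in edges_between (clist C u) (clist C v).
  by apply/imset2P; exists x y; rewrite ?inE ?yv ?exy.
have Ez : [set x; z] \in edges_between (clist C u) (clist C v).
  by apply/imset2P; exists x z; rewrite ?inE ?zv ?exz.
have [uv|euv] : u = v \/ edge u v.
- by apply: (@clist_edges _ C); apply/set0Pn; exists [set x; y].
- by rewrite uv (negPf xNv) in xu.
have /trivIsetP/(_ _ _ Ey Ez) := clist_matching C euv.
case: eqVneq => [E _|_ /(_ isT)]; last first.
  by move/disjointFl/(_ (set21 x z)); rewrite set21.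
have : y \in [set x; z] by rewrite -E set22.
case/set2P=> // yx; by rewrite yx edge_irr in exy.
Qed.

(* Greedy choice succeeds when every list has more than [#|G|] vertices. *)
Lemma DP_colorable_exists (G : sgraph) :
  exists k, (0 < k) && `[< DP_colorable G k >].
Proof.
exists #|G|.+1; apply/asboolP => C kC.
suff /(_ (enum G) (enum_uniq G))[I [indI cI _]] : forall s : seq G, uniq s ->
    exists I : {set cgraph C}, [/\ independent I, #|I| = size s
      & forall x, x \in I -> exists2 u, u \in s & x \in clist C u].
  by exists I; split; rewrite // cI cardE.
elim=> [_|v s IHs /= /andP[vs us]].
  exists set0; split=> [||x]; rewrite ?cards0 ?inE //.
  by apply/forall_inP => x; rewrite inE.
have [I [indI cI sI]] := IHs us.
pose f (x : cgraph C) := odflt x [pick y in clist C v | edge x y].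
have INv x : x \in I -> x \notin clist C v.
  move=> /sI[u us' xu]; apply/negP => xv.
  have uv : u != v by apply: contraNneq vs => <-.
  by rewrite (disjointFr (clist_disjoint C uv) xu) in xv.
have /subsetPn[y yv yNf] : ~~ (clist C v \subset f @: I).
  apply/negP => /subset_leq_card; apply/negP; rewrite -ltnNge kC ltnS.
  apply: leq_trans (leq_imset_card _ _) _.
  by rewrite cI -(card_uniqP us) max_card.
have NIy x : x \in I -> ~~ edge x y.
  move=> xI; apply/negP => exy; case/imsetP: yNf; exists x => //.
  rewrite /f; case: pickP => [z /andP[zv exz]|/(_ y)]; last by rewrite yv exy.
  exact: (cover_neighbor_uniq (INv _ xI) yv zv exy exz).
have yNI : y \notin I by apply: contraL yv; apply: INv.
exists (y |: I); split.
- apply/forall_inP => a /setU1P[->|aI]; apply/forall_inP => b /setU1P[->|bI].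
  + by rewrite edge_irr.
  + by rewrite edge_sym NIy.
  + exact: NIy.
  + by move/forall_inP/(_ a aI)/forall_inP/(_ b bI): indI.
- by rewrite cardsU1 yNI cI.
- move=> x /setU1P[->|/sI[u us' xu]]; first by exists v; rewrite ?mem_head.
  by exists u; rewrite // inE us' orbT.
Qed.

Definition chi_DP (G : sgraph) : nat := ex_minn (DP_colorable_exists G).

Definition Kbip_rel k t (x y : 'I_k + 'I_t) : bool :=
  match x, y with
  | inl _, inr _ | inr _, inl _ => true
  | _, _ => false
  end.

Lemma Kbip_sym k t : symmetric (@Kbip_rel k t).
Proof. by case=> ? []. Qed.

Lemma Kbip_irr k t : irreflexive (@Kbip_rel k t).
Proof. by case. Qed.

Definition Kbip (k t : nat) : sgraph := SGraph (@Kbip_sym k t) (@Kbip_irr k t).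

(* Main.v *)
(** Choosing one vertex from the list of each of the [k] vertices on the left
    gives [k ^ k] partial colourings.  Such a choice cannot be extended to a
    right vertex [v] only if its [k] elements kill all [k] elements of the list
    of [v]; as each kills at most one, this is a bijection onto that list, and
    the matchings recover the choice from the bijection.  So [v] rules out at
    most [k!] choices, and [t * k! < k ^ k] leaves a good one. *)

Require Import Defs.
From mathcomp Require Import all_boot all_order all_algebra.

Import GRing.Theory Num.Theory.

Section Covers.
Variables (G : sgraph) (C : Defs.cover G).
Implicit Types u v : G.

Lemma clist_inj u v (x : cgraph C) :
  x \in clist C u -> x \in clist C v -> u = v.
Proof.
move=> xu xv; apply/eqP; apply: contraLR xv => uv.
by rewrite (disjointFr (clist_disjoint C uv) xu).
Qed.

Lemma clist_edge u v (x y : cgraph C) :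
  x \in clist C u -> y \in clist C v -> edge x y -> u = v \/ edge u v.
Proof.
move=> xu yv exy; apply: (clist_edges (c := C)); apply/set0Pn.
by exists [set x; y]; apply/imset2P; exists x y; rewrite ?inE ?yv ?exy.
Qed.

(** Lists are pairwise disjoint, so [h] is injective and its image has [#|G|] elements. An edge of
    the cover joins vertices of one list or of adjacent lists, so only adjacent pairs need
    checking. *)
Lemma transversal_coloring (h : G -> cgraph C) :
  (forall u, h u \in clist C u) ->
  (forall u v, edge u v -> ~~ edge (h u) (h v)) ->
  coloring (h @: [set: G]).
Proof.
move=> hL hE; split; last first.
  rewrite card_imset ?cardsT // => u v huv.
  by apply: (clist_inj u v (h u)); rewrite // huv.
apply/forall_inP => _ /imsetP[u _ ->]; apply/forall_inP => _ /imsetP[v _ ->].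
apply/negP => e; case: (clist_edge _ _ _ _ (hL u) (hL v) e) => [uv|/hE].
  by rewrite uv edge_irr in e.
by rewrite e.
Qed.

End Covers.

Section Kbip.
Variables (k t : nat) (C : Defs.cover (Kbip k t)).
Hypothesis kC : kfold k C.

Let Ll (i : 'I_k) : {set cgraph C} := clist C (inl i : Kbip k t).
Let Lr (j : 'I_t) : {set cgraph C} := clist C (inr j : Kbip k t).

Definition left_choices : {set {ffun 'I_k -> cgraph C}} :=
  [set f in family Ll].

Definition blocked (j : 'I_t) : {set {ffun 'I_k -> cgraph C}} :=
  [set f in left_choices | [forall y in Lr j, exists i, edge (f i) y]].

Lemma card_left_choices : #|left_choices| = k ^ k.
Proof.
rewrite cardsE card_family foldrE big_map big_enum /=.
rewrite (eq_bigr (fun=> k)) => [|i _]; last exact: kC.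
by rewrite prod_nat_const card_ord.
Qed.

Lemma lists_disjoint i j x : x \in Ll i -> x \notin Lr j.
Proof. by move=> xi; apply/negP => /(clist_inj _ _ _ _ _ xi). Qed.

Lemma card_blocked j : #|blocked j| <= k`!.
Proof.
(* The default [f i] lies outside [Lr j], so [N f i \in Lr j] certifies that a neighbour was
   found. *)
pose N (f : {ffun 'I_k -> cgraph C}) : {ffun 'I_k -> cgraph C} :=
  [ffun i => odflt (f i) [pick y in Lr j | edge (f i) y]].
have imN f : f \in blocked j -> N f @: 'I_k = Lr j.
  rewrite !inE => /andP[/familyP fL /forall_inP bf].
  (* The image has at most [k] elements and [Lr j] has exactly [k], so covering [Lr j] is enough. *)
  apply/esym/eqP; rewrite eqEcard.
  rewrite {2}/Lr kC (leq_trans (leq_imset_card _ _)) ?card_ord // andbT.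
  apply/subsetP => y yL; have /existsP[i ei] := bf y yL.
  apply/imsetP; exists i => //; rewrite ffunE.
  case: pickP => [z /andP[zL ez]|/(_ y)]; last by rewrite yL ei.
  exact: (cover_neighbor_uniq (lists_disjoint _ _ _ (fL i)) yL zL ei ez).
have Nedge f i : f \in blocked j -> edge (f i) (N f i).
  move=> fB; have : N f i \in Lr j by rewrite -(imN f fB) imset_f.
  rewrite ffunE; case: pickP => [z /andP[]//|_ /=].
  move: fB; rewrite !inE => /andP[/familyP fL _].
  by rewrite (negPf (lists_disjoint _ _ _ (fL i))).
have Ninj : {in blocked j &, injective N}.
  move=> f g fB gB Nfg; apply/ffunP => i.
  have fi : f i \in Ll i by move: fB; rewrite !inE => /andP[/familyP].
  have gi : g i \in Ll i by move: gB; rewrite !inE => /andP[/familyP].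
  have NL : N f i \in Lr j by rewrite -(imN f fB) imset_f.
  (* The matching is now read from right to left: [f i] and [g i] are both neighbours in [Ll i] of
     the same vertex [N f i]. *)
  apply: (@cover_neighbor_uniq _ C (inl i : Kbip k t) (N f i)) => //.
  - by apply: contraL NL; apply: lists_disjoint.
  - by rewrite edge_sym Nedge.
  - by rewrite edge_sym Nfg Nedge.
rewrite -(card_in_imset Ninj).
have -> : k`! = #|[set f : {ffun 'I_k -> cgraph C} in ffun_on (mem (Lr j))
                   | injectiveb f]|.
  by rewrite card_inj_ffuns_on card_ord [#|_|]kC ffactnn.
apply/subset_leq_card/subsetP => _ /imsetP[f fB ->]; rewrite inE; apply/andP.
split; first by apply/ffun_onP => i; rewrite -(imN f fB) imset_f.
(* A map from [k] indices onto the [k] elements of [Lr j] is injective. *)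
have /imset_injP Nf : #|N f @: 'I_k| == #|'I_k|.
  by rewrite (imN f fB) [#|Lr j|]kC card_ord.
by apply/injectiveP => a b; apply: Nf.
Qed.

Lemma unblocked_choice :
  t * k`! < k ^ k -> exists2 f, f \in left_choices & forall j, f \notin blocked j.
Proof.
rewrite -card_left_choices => lt_tk.
have /subsetPn[f fX fB] : ~~ (left_choices \subset \bigcup_j blocked j).
  apply: contraL lt_tk => /subset_leq_card le; rewrite -leqNgt.
  apply: leq_trans le _.
  apply: (@leq_trans (\sum_(j < t) k`!)); last by rewrite sum_nat_const card_ord.
  elim/big_ind2: _ => [|m A n B mA nB|j _]; rewrite ?cards0 ?card_blocked //.
  by apply: leq_trans (leq_card_setU _ _) _; apply: leq_add.
by exists f => // j; apply: contra fB => fj; apply/bigcupP; exists j.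
Qed.

(** An unblocked choice leaves a free vertex in each right list. These can be picked independently,
    since no two right vertices are adjacent. *)
Lemma Kbip_coloring :
  t * k`! < k ^ k -> exists I : {set cgraph C}, coloring I.
Proof.
case/unblocked_choice => f fX fB.
have freeP j : exists y, (y \in Lr j) && [forall i, ~~ edge (f i) y].
  have := fB j; rewrite inE fX /= negb_forall => /existsP[y].
  rewrite negb_imply => /andP[yL]; rewrite negb_exists => yf.
  by exists y; rewrite yL.
pose g j := xchoose (freeP j).
have gE i j : ~~ edge (f i) (g j).
  by have /andP[_ /forallP] := xchooseP (freeP j).
pose h (u : Kbip k t) := match u with inl i => f i | inr j => g j end.
exists (h @: [set: Kbip k t]); apply: transversal_coloring.
  case=> [i|j] /=; last by have /andP[] := xchooseP (freeP j).
  by move: fX; rewrite inE => /familyP.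
by move=> [i|j] [i'|j'] //= _; rewrite ?gE // edge_sym gE.
Qed.

End Kbip.

Theorem theorem4 (k t : nat) (hk : (0 < k)%N) (ht : (0 < t)%N)
    (hlt : (t%:R < k%:R ^+ k / (k`!)%:R :> rat)%R) :
  (chi_DP (Kbip k t) < k + 1)%N.
Proof.
have lt_tk : t * k`! < k ^ k.
  move: hlt; rewrite ltr_pdivlMr ?ltr0n ?fact_gt0 //.
  by rewrite -natrX -natrM ltr_nat.
(* By minimality of [chi_DP], it suffices that every [k]-fold cover has a coloring. *)
rewrite addn1 ltnS /chi_DP; case: ex_minnP => m _; apply.
by rewrite hk; apply/boolp.asboolP => C kC; apply: Kbip_coloring.
Qed.
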